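(* Let $d\geq 1$ and let $\Phi:\mathbb{R}^d\times M\to M$ be a continuous $\mathbb{R}^d$-action on a compact metric space $M$. If there exists $v\in\mathbb{R}^d$ such that $(\Phi_{tv})_{t\in\mathbb{R}}$ is a fixed point free separating flow, then the orbits of $\Phi$ are curves in $M$ and coincide with the orbits of the flow $(\Phi_{tv})_{t\in\mathbb{R}}$; that is, $\{\Phi_u(x):u\in\mathbb{R}^d\}=\{\Phi_{tv}(x):t\in\mathbb{R}\}$ for every $x\in M$.
   Context: A continuous $\mathbb{R}^d$-action on $M$ is a continuous map $\Phi:\mathbb{R}^d\times M\to M$ such that, with $\Phi_v=\Phi(v,\cdot)$, $\Phi_0=\mathrm{id}$, each $\Phi_v$ is a homeomorphism, and $\Phi_{v+u}=\Phi_v\circ\Phi_u$ for all $u,v\in\mathbb{R}^d$. The orbit of $x$ under $\Phi$ is $\{\Phi_u(x):u\in\mathbb{R}^d\}$. For a continuous flow $\phi$ on $M$ (a continuous $\mathbb{R}$-action, $\phi_t=\phi(t,\cdot)$), $Orb(x,\phi)=\{\phi_t(x):t\in\mathbb{R}\}$; $x$ is a fixed point if $Orb(x,\phi)=\{x\}$; $\phi$ is fixed point free if it has no fixed points; and $\phi$ is separating if there is $\delta>0$ such that for all $x,y\in M$: if $d(\phi_t(x),\phi_t(y))<\delta$ for all $t\in\mathbb{R}$, then $y\in Orb(x,\phi)$, where $d$ here denotes the metric of $M$. *)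

(* Defs.v *)
From HB Require Import structures.
From mathcomp Require Import all_boot all_order all_algebra.
From mathcomp Require Import all_classical all_reals all_analysis.

Set Implicit Arguments.
Unset Strict Implicit.
Unset Printing Implicit Defensive.

Import Order.TTheory GRing.Theory Num.Theory.
Import numFieldNormedType.Exports.

Local Open Scope classical_set_scope.
Local Open Scope ring_scope.

(* For a dimension d that is not syntactically a successor, the existing
   additive group and (entrywise) topology on 'rV[R]_d are not yet joined. *)
HB.instance Definition _ (R : realType) (d : nat) := Topological.on 'rV[R]_d.

Definition homeomorphism (T U : topologicalType) (f : T -> U) : Prop :=
  continuous f /\
  exists g : U -> T, [/\ cancel f g, cancel g f & continuous g].

(* Continuity of the action is joint continuity on the product G * M.  The
   group G is meant to be R ^ d (as 'rV[R]_d) or the real line R (flows). *)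
Record continuous_action (G : PreTopologicalZmodule.type) (M : topologicalType)
    (Phi : G -> M -> M) : Prop := ContinuousAction {
  action_continuous : continuous (fun p : G * M => Phi p.1 p.2) ;
  action0 : forall x, Phi 0 x = x ;
  action_homeo : forall v, homeomorphism (Phi v) ;
  actionD : forall u v x, Phi (v + u) x = Phi v (Phi u x)
}.

Definition action_orbit (G M : Type) (Phi : G -> M -> M) (x : M) : set M :=
  [set Phi u x | u in [set: G]].

Definition fixed_point_free (G M : Type) (phi : G -> M -> M) : Prop :=
  ~ exists x, action_orbit phi x = [set x].

Definition separating (R : realType) (M : metricType R) (phi : R -> M -> M) :
    Prop :=
  exists2 delta : R, 0 < delta & forall x y : M,
    (forall t, mdist (phi t x) (phi t y) < delta) -> action_orbit phi x y.

Definition line_flow (R : realType) (d : nat) (M : Type)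
    (Phi : 'rV[R]_d -> M -> M) (v : 'rV[R]_d) : R -> M -> M :=
  fun t => Phi (t *: v).

(* A curve is the image of an immersed (continuous, locally injective)
   real line.  Local injectivity rules out constant maps as well as
   space-filling parametrizations; closed curves are allowed. *)
Definition curve (R : realType) (M : topologicalType) (C : set M) : Prop :=
  exists gamma : R -> M,
    [/\ continuous gamma,
        forall t, exists2 e : R, 0 < e & forall r s,
          `|r - t| < e -> `|s - t| < e -> gamma r = gamma s -> r = s
      & C = range gamma].

(* Main.v *)
(* If u is small, compactness makes Phi_u uniformly delta-close to the identity.
   Since Phi_u commutes with the flow, the flow lines of x and Phi_u(x) stay
   delta-close, so separation puts Phi_u(x) on the flow line of x; writing an
   arbitrary u as n (u / n) extends this to all u.  The flow line is immersed
   because arbitrarily small periods would generate a dense group of periods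
   and so make x a fixed point. *)
Require Import Defs.
From mathcomp Require Import all_boot all_order all_algebra.
From mathcomp Require Import all_classical all_reals all_analysis.
From mathcomp Require Import lra.

Set Implicit Arguments.
Unset Strict Implicit.
Unset Printing Implicit Defensive.

Import Order.TTheory GRing.Theory Num.Theory.
Import numFieldNormedType.Exports.

Local Open Scope classical_set_scope.
Local Open Scope ring_scope.

(** Since [f t0] is the identity, joint continuity at [(t0, x)] bounds the displacement for [t] near
    [t0] and points near [x]. The near-covering form of compactness then makes the neighbourhood of
    [t0] independent of [x]. *)
Lemma small_displacement (R : realType) (T : topologicalType) (M : metricType R)
    (f : T -> M -> M) (t0 : T) (delta : R) :
  compact [set: M] -> continuous (fun p : T * M => f p.1 p.2) ->
  (forall x, f t0 x = x) -> 0 < delta ->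
  \forall t \near t0, forall x, mdist (f t x) x < delta.
Proof.
move=> /compact_near_coveringP cM fc f0 delta0.
have : \forall t \near t0, [set: M] `<=` (fun x => mdist (f t x) x < delta).
  apply: (cM _ (nbhs t0) (fun t x => mdist (f t x) x < delta)) => x _.
  have d2 : 0 < delta / 2 by rewrite divr_gt0.
  have near_x : \forall y \near x, mdist x y < delta / 2.
    exact: (@metricType_numDomainType.cvgr_dist_lt _ M _ (nbhs x) _ id x).
  have near_f : \forall p \near (t0, x), mdist x (f p.1 p.2) < delta / 2.
    apply: (@metricType_numDomainType.cvgr_dist_lt _ M _ (nbhs (t0, x))) => //.
    by rewrite -[X in _ --> X](f0 x); exact: (fc (t0, x)).
  have [[A B] /= [At Bx] AB] := near_f.
  (* Both [y] and [f t y] are kept within [delta / 2] of the centre [x], through which the triangle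
     inequality passes. *)
  exists (B `&` (fun y => mdist x y < delta / 2), A) => /=.
    by split=> //; exact: filterI.
  move=> -[y t] /= [[By xy] Ay].
  apply: le_lt_trans (metric_triangle _ x _) _.
  by rewrite [ltRHS]splitr ltrD// metric_sym; exact: (AB (t, y)).
by apply: filterS => t ht x; exact: ht.
Qed.

Lemma line_flow_continuous (R : realType) (d : nat) (M : metricType R)
    (Phi : 'rV[R]_d -> M -> M) (u : 'rV[R]_d) :
  continuous_action Phi ->
  continuous (fun p : R * M => line_flow Phi u p.1 p.2).
Proof.
move=> [Phic _ _ _] [s x].
apply: (@continuous_comp _ _ _ (fun p : R * M => (p.1 *: u, p.2))
  (fun p : 'rV[R]_d * M => Phi p.1 p.2)); last exact: Phic.
have su : (p.1 *: u) @[p --> (s, x)] --> s *: u.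
  by apply: (@cvgZr_tmp R 'rV[R]_d _ _ _ fst s u); exact: cvg_fst.
exact: (cvg_pair su cvg_snd).
Qed.

Lemma action_orbit_trans (G : PreTopologicalZmodule.type) (M : topologicalType)
    (Phi : G -> M -> M) (x y z : M) : continuous_action Phi ->
  action_orbit Phi x y -> action_orbit Phi y z -> action_orbit Phi x z.
Proof.
by move=> [_ _ _ PhiD] [u _ <-] [v _ <-]; exists (v + u) => //; rewrite PhiD.
Qed.

Lemma orbit_line_flow (R : realType) (d : nat) (M : metricType R)
    (Phi : 'rV[R]_d -> M -> M) (v : 'rV[R]_d) :
  compact [set: M] -> continuous_action Phi ->
  continuous_action (line_flow Phi v) -> separating (line_flow Phi v) ->
  forall x, action_orbit Phi x = action_orbit (line_flow Phi v) x.
Proof.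
move=> cM actPhi actv [delta delta0 sep] x; apply/seteqP; split; last first.
  by move=> _ [t _ <-]; exists (t *: v).
have [_ Phi0 _ PhiD] := actPhi.
move=> _ [u _ <-].
(* Smallness is measured along the line spanned by [u], so that only a scalar time has to be
   small. *)
have : \forall s \near (0 : R), forall y, mdist (line_flow Phi u s y) y < delta.
  apply: small_displacement => //; first exact: line_flow_continuous.
  by move=> y; rewrite /line_flow scale0r.
move=> /nbhs_ballP[e /= e0 small].
have [n ne] : exists n : nat, n.+1%:R^-1 < e.
  exact: filter_ex (near_infty_natSinv_lt (PosNum e0)).
pose w := n.+1%:R^-1 *: u.
have step y : action_orbit (line_flow Phi v) y (Phi w y).
  (* Commutativity turns the distance at time [t] into the displacement by [Phi w] of the single
     point [Phi (t *: v) y], which [small] bounds for every [t]. *)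
  apply: sep => t; rewrite metric_sym /line_flow -PhiD addrC PhiD.
  apply: small; rewrite /ball/= sub0r normrN gtr0_norm//.
have iter k : action_orbit (line_flow Phi v) x (Phi (w *+ k) x).
  elim: k => [|k IHk]; first by exists 0 => //; rewrite mulr0n /line_flow scale0r.
  by apply: action_orbit_trans IHk _ => //; rewrite mulrS PhiD.
suff -> : u = w *+ n.+1 by exact: iter.
by rewrite -scaler_nat scalerA divff ?scale1r// pnatr_eq0.
Qed.

Lemma continuous_orbit_map (G : PreTopologicalZmodule.type)
    (M : topologicalType) (Phi : G -> M -> M) (x : M) :
  continuous_action Phi -> continuous (Phi^~ x).
Proof.
move=> [Phic _ _ _] u.
apply: (@continuous_comp _ _ _ (fun w : G => (w, x))
  (fun p : G * M => Phi p.1 p.2)); last exact: Phic.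
exact: (cvg_pair cvg_id (cvg_cst x)).
Qed.

(** Integer multiples of a period are periods, so arbitrarily small periods give return times to [x]
    arbitrarily close to any [t]. Continuity at [t] then forces [phi t x = x]. *)
Lemma small_periods_fixed (R : realType) (M : metricType R) (phi : R -> M -> M)
    (x : M) : continuous_action phi ->
  (forall e, 0 < e -> exists p, 0 < p < e /\ phi p x = x) ->
  action_orbit phi x = [set x].
Proof.
move=> act periods; have [_ phi0 _ phiD] := act; apply/seteqP; split; last first.
  by move=> _ ->; exists 0.
move=> _ [t _ <-] /=; apply/eqP/negP => /negP; rewrite -mdist_gt0 => dist0.
have contx : continuous (phi^~ x) by exact: continuous_orbit_map.
(* The radius is the distance from [phi t x] to [x] itself, so a return to [x] at a time near [t] is
   contradictory. *)
have := @metricType_numDomainType.cvgr_dist_lt _ M _ _ _ _ _ (contx t) _ dist0.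
move=> /(_ _)/nbhs_ballP[e /= e0 near_t].
have [p [/andP[p0 pe] px]] := periods e e0.
have natper k : phi (p *+ k) x = x.
  by elim: k => [|k IHk]; rewrite ?mulr0n// mulrS phiD IHk.
have intper (k : int) : phi (p *~ k) x = x.
  case: k => k; first exact: natper.
  by rewrite NegzE mulrNz -{1}(natper k.+1) -phiD addNr.
(* Rounding [t / p] down gives a multiple of [p] at distance at most [p < e] from [t]; negative [t]
   is why [intper] covers all integers. *)
suff /near_t : ball t e (p *~ Num.floor (t / p)) by rewrite /= intper ltxx.
have /andP[fl fu] := floor_itv (t / p).
rewrite /ball/= -mulrzr; apply: le_lt_trans pe.
have tp : t = p * (t / p) by rewrite mulrC divfK// gt_eqF.
rewrite {1}tp -mulrBr normrM gtr0_norm// ler_piMr ?(ltW p0)//.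
rewrite ger0_norm ?subr_ge0// lerBlDl.
by rewrite intrD in fu; exact: ltW.
Qed.

Theorem corollary1p3 (R : realType) (d : nat) (M : metricType R)
    (Phi : 'rV[R]_d -> M -> M) (v : 'rV[R]_d) :
  (1 <= d)%N ->
  compact [set: M] ->
  continuous_action Phi ->
  continuous_action (line_flow Phi v) ->
  fixed_point_free (line_flow Phi v) ->
  separating (line_flow Phi v) ->
  forall x : M,
    curve R (action_orbit Phi x) /\
    action_orbit Phi x = action_orbit (line_flow Phi v) x.
Proof.
move=> _ cM actPhi actv free sep x.
have orbE := orbit_line_flow cM actPhi actv sep x.
split; rewrite ?orbE//; exists ((line_flow Phi v)^~ x); split=> //.
  exact: continuous_orbit_map.
move=> t; have [e e0 noper] : exists2 e : R, 0 < e &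
    forall p, 0 < p < e -> line_flow Phi v p x <> x.
  apply: contrapT => noe; apply: free; exists x.
  apply: small_periods_fixed => // e e0.
  apply: contrapT => nop; apply: noe; exists e => // p pe px.
  by apply: nop; exists p.
(* Two times within [e / 2] of [t] differ by less than [e]. If they reach the same point, their
   positive difference is a period of [x] below [e], against [noper]. *)
exists (e / 2) => [|r s]; first by rewrite divr_gt0.
wlog rs : r s / s < r => [hwlog rt st rsx|rt st rsx].
  by case: (ltgtP r s) => // h; [apply/esym|]; apply: hwlog.
have [_ phi0 _ phiD] := actv.
have [] := noper (r - s).
  rewrite subr_gt0 rs/=; move: rt st; rewrite !ltr_norml; lra.
by rewrite addrC phiD rsx -phiD addNr phi0.
Qed.
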